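(* Consider a planar non-collinear four-body central configuration with $\alpha_{23}^\perp,\alpha_{24}^\perp,\alpha_{34}^\perp\neq0$, and let $$P(\lambda):=\det(\lambda L^\Delta_{\mathrm{reg}}-\widetilde L).$$ Then there are real numbers $c_4,c_5$ such that $$P(\lambda)=\lambda^4(c_6\lambda^2+c_5\lambda+c_4),\qquad c_6=\det(L^\Delta_{\mathrm{reg}})>0.$$ Moreover, the two roots of $c_6\lambda^2+c_5\lambda+c_4=0$ are precisely the nonzero generalized eigenvalues of $(\widetilde L|_{\mathcal W},L^\Delta|_{\mathcal W})$. Consequently, $H_{\mathcal C}|_{\mathcal W}$ is positive definite if and only if both roots are strictly greater than $-1$.
   Context: Four bodies have masses $m_1,\dots,m_4>0$, $M=\sum_i m_i$, pairwise distinct positions $\mathbf r_i\in\mathbb R^2$ with $\sum_i m_i\mathbf r_i=0$; $\mathbf q_{ij}=\mathbf r_i-\mathbf r_j$, $q_{ij}=|\mathbf q_{ij}|$, $\hat{\mathbf q}_{ij}=\mathbf q_{ij}/q_{ij}$, $\mu_{ij}=m_im_j/M$. The configuration is central if there is $\omega^2>0$ with $\omega^2m_i\mathbf r_i=\sum_{j\ne i}\frac{m_im_j}{q_{ij}^3}\mathbf q_{ij}$ for all $i$ (such $\omega^2$ is then uniquely determined). It is non-collinear if the four positions do not lie on one line. Put $\alpha_{ij}^\perp=\alpha_{ji}^\perp=\mu_{ij}(\omega^2-M/q_{ij}^3)$, $\delta_{ij}=3M\mu_{ij}/q_{ij}^3$, $\mathbf D_{ij}=\mathbf D_{ji}=\delta_{ij}\hat{\mathbf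 q}_{ij}\hat{\mathbf q}_{ij}^T$. With indices $a,b\in\{2,3,4\}$ and sums over $k\in\{1,2,3,4\}$, $k\ne a$: $\ell\in\mathbb R^{3\times3}$ is $\ell_{a-1,a-1}=\sum_{k\ne a}\alpha_{ak}^\perp$, $\ell_{a-1,b-1}=-\alpha_{ab}^\perp$ $(a\ne b)$; $\widetilde L=\ell\otimes\mathbf I_2\in\mathbb R^{6\times6}$; the gap Laplacian $L^\Delta\in\mathbb R^{6\times6}$ is the $3\times3$ array of $2\times2$ blocks $(L^\Delta)_{a-1,a-1}=\sum_{k\ne a}\mathbf D_{ak}$, $(L^\Delta)_{a-1,b-1}=-\mathbf D_{ab}$ $(a\neq b)$; the restricted Hessian is $H_{\mathcal C}=L^\Delta+\widetilde L$. $\mathbf q=(\mathbf q_{12}^T,\mathbf q_{13}^T,\mathbf q_{14}^T)^T\in\mathbb R^6$, $\mathbf J=\begin{pmatrix}0&-1\\1&0\end{pmatrix}$, $\mathbb J=\mathbf I_3\otimes\mathbf J$, $\mathbf v=\mathbb J\mathbf q$ (rotational mode), $\mathcal W=\mathbf v^\perp\subset\mathbb R^6$, and $L^\Delta_{\mathrm{reg}}=L^\Delta+\frac{\mathbf v\mathbf v^T}{\|\mathbf v\|^2}$. Restrictions to $\mathcal W$ are restrictions of the associated quadratic forms (equivalently operators, since $L^\Delta$ and $\widetilde L$ map $\mathcal W$ to itself). A generalized eigenvalue of $(\widetilde L|_{\mathcal W},L^\Delta|_{\mathcal W})$ is a number $\lambda$ for which there is a nonzero $\mathbf x\in\mathcal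 W$ with $\widetilde L\mathbf x=\lambda L^\Delta\mathbf x$. *)

(* Defs.v *)
From mathcomp Require Import all_boot all_order all_algebra.
From mathcomp Require Import mxtens reals.

Set Implicit Arguments.
Unset Strict Implicit.
Unset Printing Implicit Defensive.

Import Order.TTheory GRing.Theory Num.Theory.
Local Open Scope ring_scope.

(* Bodies 1, 2, 3, 4 are the ordinals 0, 1, 2, 3 of 'I_4.  The block index
   a : 'I_3 (that is, a - 1 in 1-based numbering) refers to the body
   [lift ord0 a], so it ranges over the bodies 2, 3, 4. *)
Definition body2 : 'I_4 := @Ordinal 4 1 isT.
Definition body3 : 'I_4 := @Ordinal 4 2 isT.
Definition body4 : 'I_4 := @Ordinal 4 3 isT.

Section Euclidean.
Variables (R : realType) (n : nat).

(* The norm instance of mathcomp-analysis on matrices is the sup norm, hence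
   the explicit Euclidean one. *)
Definition dot (x y : 'cV[R]_n) : R := \sum_i x i 0 * y i 0.
Definition enorm (x : 'cV[R]_n) : R := Num.sqrt (dot x x).

Definition orth_compl (v : 'cV[R]_n) : {pred 'cV[R]_n} :=
  [pred x | dot v x == 0].

Definition posdef_on (W : {pred 'cV[R]_n}) (A : 'M[R]_n) : Prop :=
  forall x, x \in W -> x != 0 -> 0 < dot x (A *m x).

Definition gen_eigenvalue_on (W : {pred 'cV[R]_n}) (A B : 'M[R]_n)
    (lam : R) : Prop :=
  exists x, [/\ x \in W, x != 0 & A *m x = lam *: (B *m x)].

Definition pencil_poly (A B : 'M[R]_n) : {poly R} :=
  \det ('X *: map_mx polyC B - map_mx polyC A).

End Euclidean.

(* The entry (s, t) of the block (i, j) sits in row 2 i + s and column 2 j + t,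
   the indexing used by the Kronecker product [*t]. *)
Definition block3 (R : realType) (B : 'I_3 -> 'I_3 -> 'M[R]_2) :
    'M[R]_(3 * 2) :=
  \matrix_(i, j) B (mxtens_unindex i).1 (mxtens_unindex j).1
                   (mxtens_unindex i).2 (mxtens_unindex j).2.

Section FourBody.
Variables (R : realType) (m : 'I_4 -> R) (r : 'I_4 -> 'cV[R]_2).

Definition total_mass : R := \sum_i m i.
Definition qvec (i j : 'I_4) : 'cV[R]_2 := r i - r j.
Definition qdist (i j : 'I_4) : R := enorm (qvec i j).
Definition qhat (i j : 'I_4) : 'cV[R]_2 := (qdist i j)^-1 *: qvec i j.
Definition mu (i j : 'I_4) : R := m i * m j / total_mass.

Definition collinear : Prop :=
  exists p d : 'cV[R]_2, d != 0 /\ forall i, exists t : R, r i = p + t *: d.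

Definition central_with (w2 : R) : Prop :=
  0 < w2 /\
  forall i, (w2 * m i) *: r i
          = \sum_(j | j != i) (m i * m j / qdist i j ^+ 3) *: qvec i j.

Definition delta (i j : 'I_4) : R := 3 * total_mass * mu i j / qdist i j ^+ 3.
Definition Dmx (i j : 'I_4) : 'M[R]_2 :=
  delta i j *: (qhat i j *m (qhat i j)^T).

Definition gap_laplacian : 'M[R]_(3 * 2) :=
  block3 (fun a b =>
    if a == b then \sum_(k | k != lift ord0 a) Dmx (lift ord0 a) k
    else - Dmx (lift ord0 a) (lift ord0 b)).

Definition qcol : 'cV[R]_(3 * 2) :=
  \col_i qvec ord0 (lift ord0 (mxtens_unindex i).1) (mxtens_unindex i).2 0.

Definition Jmx : 'M[R]_2 := \matrix_(i, j) ((j < i)%N%:R - (i < j)%N%:R).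
Definition rot_mode : 'cV[R]_(3 * 2) := ((1%:M : 'M[R]_3) *t Jmx) *m qcol.

Definition gap_laplacian_reg : 'M[R]_(3 * 2) :=
  gap_laplacian + (enorm rot_mode ^+ 2)^-1 *: (rot_mode *m rot_mode^T).

Variable w2 : R.

Definition alpha_perp (i j : 'I_4) : R :=
  mu i j * (w2 - total_mass / qdist i j ^+ 3).

Definition ell : 'M[R]_3 :=
  \matrix_(a, b)
    if a == b then \sum_(k | k != lift ord0 a) alpha_perp (lift ord0 a) k
    else - alpha_perp (lift ord0 a) (lift ord0 b).

Definition Ltilde : 'M[R]_(3 * 2) := ell *t (1%:M : 'M[R]_2).

Definition restricted_hessian : 'M[R]_(3 * 2) := gap_laplacian + Ltilde.

End FourBody.

(* Main.v *)
(* With y the vector of cross products of q_12, q_13, q_14, the relations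
   sum_j alpha_ij q_ij = 0 say that both coordinate columns of (q_1a)_a are in
   the kernel of ell; being symmetric with nonzero off-diagonal entries, ell is
   then c y y^T with c != 0 and every y_a != 0.  Hence Ltilde = c U U^T with
   U = y (x) I_2 of rank 2.  Since y has no zero entry, the complete graph on
   the four bodies is infinitesimally rigid, so the kernel of L^Delta is spanned by
   the rotational mode and L_reg is positive definite.  As A B and B A have the
   same characteristic polynomial up to a power of X, the pencil reduces to that
   of the symmetric 2 x 2 matrix c U^T L_reg^-1 U. *)
Require Import Defs.
From mathcomp Require Import all_boot all_order all_algebra.
From mathcomp Require Import mxtens reals ring lra.

Set Implicit Arguments.
Unset Strict Implicit.
Unset Printing Implicit Defensive.

Import Order.TTheory GRing.Theory Num.Theory.
Local Open Scope ring_scope.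

(** * Euclidean inner product on column vectors *)

Lemma dotE (R : realType) n (x y : 'cV[R]_n) : dot x y = (x^T *m y) 0 0.
Proof. by rewrite mxE; apply: eq_bigr => i _; rewrite mxE. Qed.

Lemma dotC (R : realType) n (x y : 'cV[R]_n) : dot x y = dot y x.
Proof. by apply: eq_bigr => i _; rewrite mulrC. Qed.

Lemma dotDr (R : realType) n (x y z : 'cV[R]_n) :
  dot x (y + z) = dot x y + dot x z.
Proof. by rewrite !dotE mulmxDr mxE. Qed.

Lemma dotDl (R : realType) n (x y z : 'cV[R]_n) :
  dot (x + y) z = dot x z + dot y z.
Proof. by rewrite dotC dotDr !(dotC z). Qed.

Lemma dotZr (R : realType) n a (x y : 'cV[R]_n) : dot x (a *: y) = a * dot x y.
Proof. by rewrite !dotE -scalemxAr mxE. Qed.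

Lemma dotZl (R : realType) n a (x y : 'cV[R]_n) : dot (a *: x) y = a * dot x y.
Proof. by rewrite dotC dotZr dotC. Qed.

Lemma dotBr (R : realType) n (x y z : 'cV[R]_n) :
  dot x (y - z) = dot x y - dot x z.
Proof. by rewrite dotDr -scaleN1r dotZr mulN1r. Qed.

Lemma dotBl (R : realType) n (x y z : 'cV[R]_n) :
  dot (x - y) z = dot x z - dot y z.
Proof. by rewrite dotC dotBr !(dotC z). Qed.

Lemma dot0r (R : realType) n (x : 'cV[R]_n) : dot x 0 = 0.
Proof. by rewrite dotE mulmx0 mxE. Qed.

Lemma dot_trmx (R : realType) m n (A : 'M[R]_(m, n)) (x : 'cV_m) (y : 'cV_n) :
  dot x (A *m y) = dot (A^T *m x) y.
Proof. by rewrite !dotE trmx_mul trmxK mulmxA. Qed.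

Lemma dot_outer (R : realType) n (v x y : 'cV[R]_n) :
  dot x (v *m v^T *m y) = dot v x * dot v y.
Proof.
by rewrite -mulmxA dot_trmx dotE mxE big_ord1 mxE -!dotE (dotC v x) dotC dotE.
Qed.

Lemma dot_ge0 (R : realType) n (x : 'cV[R]_n) : 0 <= dot x x.
Proof. by apply: sumr_ge0 => i _; rewrite -expr2 sqr_ge0. Qed.

Lemma dot_eq0 (R : realType) n (x : 'cV[R]_n) : (dot x x == 0) = (x == 0).
Proof.
apply/eqP/eqP => [x0|->]; last exact: dot0r.
apply/matrixP => i j; rewrite ord1 mxE.
move/eqP: x0; rewrite psumr_eq0 => [/allP/(_ i)|k _]; last first.
  by rewrite -expr2 sqr_ge0.
by rewrite mem_index_enum /= mulf_eq0 orbb => /(_ isT)/eqP.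
Qed.

Lemma dot_gt0 (R : realType) n (x : 'cV[R]_n) : (0 < dot x x) = (x != 0).
Proof. by rewrite lt_def dot_ge0 dot_eq0 andbT. Qed.

Lemma enorm_sqr (R : realType) n (x : 'cV[R]_n) : enorm x ^+ 2 = dot x x.
Proof. by rewrite sqr_sqrtr // dot_ge0. Qed.

Lemma ker_dot (R : realType) n (v : 'cV[R]_n) :
  (forall x, dot x v = 0) -> v = 0.
Proof. by move=> v0; apply/eqP; rewrite -dot_eq0 v0. Qed.

Lemma dot_delta (R : realType) n (A : 'M[R]_n) i j :
  dot (delta_mx i 0) (A *m delta_mx j 0) = A i j.
Proof. by rewrite dotE trmx_delta -colE -rowE !mxE. Qed.

(** * Singularity, positive definiteness and characteristic polynomials *)

Lemma det0_ker (R : realType) n (A : 'M[R]_n) :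
  \det A = 0 <-> exists2 x : 'cV_n, x != 0 & A *m x = 0.
Proof.
rewrite -det_tr; split=> [/eqP/det0P[u u0 uA]|[x x0 Ax]].
  exists u^T; first by rewrite trmx_eq0.
  by apply: trmx_inj; rewrite trmx_mul trmxK uA trmx0.
apply/eqP/det0P; exists x^T; first by rewrite trmx_eq0.
by rewrite -trmx_mul Ax trmx0.
Qed.

Lemma posdef_ker (R : realType) n (A : 'M[R]_n) :
  posdef_on predT A -> \det A != 0.
Proof.
move=> A_gt0; apply/eqP => /det0_ker[x x0 Ax].
by have := A_gt0 x isT x0; rewrite Ax dot0r ltxx.
Qed.

(* No matrix on the segment from the identity to A is singular. *)
Lemma det_posdef (R : realType) n (A : 'M[R]_n) :
  posdef_on predT A -> 0 < \det A.
Proof.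
move=> A_gt0.
pose p := \det ((1 - 'X)%:M + 'X *: map_mx polyC A).
have pE t : p.[t] = \det ((1 - t)%:M + t *: A).
  rewrite -horner_evalE -det_map_mx; congr (\det _); apply/matrixP => i j.
  by rewrite !mxE /= horner_evalE !hornerE /= hornerMn !hornerE.
have p_neq0 t : 0 <= t <= 1 -> p.[t] != 0.
  case/andP=> t0 t1; rewrite pE; apply: posdef_ker => x _ x0.
  rewrite mulmxDl mul_scalar_mx -scalemxAl dotDr !dotZr.
  have /= := A_gt0 x isT x0; have := x0; rewrite -dot_gt0 => xx xAx.
  by nra.
have p0 : p.[0] = 1 by rewrite pE scale0r addr0 subr0 det1.
have p1 : p.[1] = \det A by rewrite pE subrr scale1r raddf0 add0r.
rewrite ltNge; apply/negP => Ale0.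
(* [poly_ivt] asks for a nonpositive value at the left end and a nonnegative one at the right, hence
   [- p]. *)
have [|t t01] := @poly_ivt R (- p) 0 1 ler01.
  by rewrite !hornerN p0 p1 oppr_ge0 Ale0 andbT oppr_le0 ler01.
by rewrite rootN => /eqP pt; move: (p_neq0 t t01); rewrite pt eqxx.
Qed.

(** Column operations on the block matrix [N] with rows (X, A) and (B, 1) clear either the lower
    left or the upper right block, which evaluates its determinant in two ways. Powers of X on both
    sides leave the sizes m and n unordered. *)
Lemma char_poly_mulmxC (F : comNzRingType) m n
    (A : 'M[F]_(m, n)) (B : 'M[F]_(n, m)) :
  char_poly (A *m B) * 'X^n = char_poly (B *m A) * 'X^m.
Proof.
pose a := map_mx polyC A; pose b := map_mx polyC B.
pose N := block_mx 'X%:M a b 1%:M.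
have E1 : \det N = char_poly (A *m B).
  have := congr1 determinant (mulmx_block 'X%:M a b 1%:M 1%:M 0 (- b) 1%:M).
  rewrite det_mulmx det_lblock !det1 !mulr1 => ->.
  rewrite !mulmx1 !mul1mx !mulmx0 add0r addrN add0r det_ublock det1 mulr1.
  by rewrite mulmxN /char_poly /char_poly_mx map_mxM.
have := congr1 determinant (mulmx_block 'X%:M a b 1%:M 1%:M (- a) 0 'X%:M).
rewrite det_mulmx det_ublock det1 mul1r det_scalar E1 => ->.
rewrite !mulmx1 !mulmx0 !addr0 mul1mx mul_scalar_mx scalerN mul_mx_scalar.
rewrite addNr det_lblock det_scalar mulrC mulmxN addrC.
by rewrite /char_poly /char_poly_mx map_mxM.
Qed.

(** * Two by two matrices and binary quadratic forms *)

Lemma det_mx2 (F : comNzRingType) (A : 'M[F]_2) :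
  \det A = A 0 0 * A 1 1 - A 0 1 * A 1 0.
Proof.
rewrite (expand_det_row _ 0) !big_ord_recl big_ord0 addr0 /cofactor.
rewrite !det_mx11 !mxE /= expr0 expr1 mul1r mulN1r mulrN.
by congr (_ * A _ _ - A _ _ * A _ _); apply: val_inj.
Qed.

Lemma sum_ord2 (V : nmodType) (F : 'I_2 -> V) : \sum_i F i = F 0 + F 1.
Proof.
by rewrite !big_ord_recl big_ord0 addr0; congr (_ + F _); apply: val_inj.
Qed.

Lemma dot2E (R : realType) (u v : 'cV[R]_2) :
  dot u v = u 0 0 * v 0 0 + u 1 0 * v 1 0.
Proof. exact: sum_ord2. Qed.

Lemma char_poly2 (F : comNzRingType) (A : 'M[F]_2) :
  char_poly A = 'X^2 - \tr A *: 'X + (\det A)%:P.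
Proof.
rewrite /char_poly /mxtrace !det_mx2 sum_ord2 !mxE /=.
rewrite !mulr1n !mulr0n !sub0r mulrNN polyCB !polyCM -mul_polyC polyCD.
by ring.
Qed.

(** The discriminant of the characteristic polynomial is (a - d)^2 + 4 b^2, a sum of squares, so the
    eigenvalues are real. *)
Lemma sym2_eigenvalues (R : realType) (A : 'M[R]_2) :
  A^T = A -> exists s1 s2, s1 + s2 = \tr A /\ s1 * s2 = \det A.
Proof.
move=> /matrixP/(_ 0 1); rewrite mxE => A_sym.
pose a : R := A 0 0; pose b : R := A 0 1; pose d : R := A 1 1.
have D_ge0 : 0 <= (a - d) ^+ 2 + 4 * b ^+ 2.
  by rewrite addr_ge0 ?sqr_ge0 // pmulr_rge0 ?sqr_ge0 ?ltr0n.
have := sqr_sqrtr D_ge0; set D := Num.sqrt _ => D2.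
exists ((a + d + D) / 2), ((a + d - D) / 2).
rewrite det_mx2 /mxtrace sum_ord2 A_sym -/a -/b -/d; split; first by field.
transitivity (((a + d) ^+ 2 - D ^+ 2) / 4); first by field.
by rewrite D2; field.
Qed.

(** Positive trace and determinant make p positive; multiplying the form by p then allows completing
    the square. *)
Lemma binary_form_gt0 (R : realType) (p q b x y : R) :
  0 < p + q -> b ^+ 2 < p * q -> (x != 0) || (y != 0) ->
  0 < p * x ^+ 2 - 2 * b * x * y + q * y ^+ 2.
Proof.
move=> pq_gt0 b_lt xy_neq0.
have p_gt0 : 0 < p by nra.
rewrite -(pmulr_rgt0 _ p_gt0).
have -> : p * (p * x ^+ 2 - 2 * b * x * y + q * y ^+ 2)
        = (p * x - b * y) ^+ 2 + (p * q - b ^+ 2) * y ^+ 2 by ring.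
have [y0|y_neq0] := eqVneq y 0.
  rewrite y0 eqxx orbF in xy_neq0 *.
  rewrite mulr0 subr0 expr0n mulr0 addr0 exprn_even_gt0 //=.
  by rewrite mulf_neq0 // gt_eqF.
by rewrite ltr_wpDl ?sqr_ge0 // mulr_gt0 ?subr_gt0 // exprn_even_gt0.
Qed.

(** * Pencils formed by a positive definite matrix and one of rank two *)

Section RankTwoPencil.
Variables (R : realType) (n : nat) (G : 'M[R]_n) (U : 'M[R]_(n, 2)) (c : R).
Hypotheses (G_sym : G^T = G) (G_gt0 : posdef_on predT G) (c_neq0 : c != 0).
Hypothesis U_inj : forall z : 'cV_2, U *m z = 0 -> z = 0.

(** The Gram matrix of the columns of U for the inner product given by the inverse of G. *)
Let S : 'M[R]_2 := U^T *m (invmx G *m U).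

Lemma posdef_unitmx : G \in unitmx.
Proof. by rewrite unitmxE unitfE posdef_ker. Qed.

Lemma gram_sym : S^T = S.
Proof. by rewrite !trmx_mul trmxK trmx_inv G_sym -mulmxA. Qed.

Lemma gram_posdef : posdef_on predT S.
Proof.
move=> z _ z0; rewrite -!mulmxA dot_trmx trmxK.
rewrite -[U *m z](mulKVmx posdef_unitmx) mulKmx ?posdef_unitmx //.
rewrite dotC; apply: G_gt0 => //; apply: contraNneq z0 => GUz.
by apply/eqP/U_inj; rewrite -[U *m z](mulKVmx posdef_unitmx) GUz mulmx0.
Qed.

(** Factoring G out of the pencil leaves the characteristic polynomial of c G^-1 U U^T; moving U^T
    to the front replaces this matrix by c S. *)
Lemma pencil_poly_rank2 :
  pencil_poly (c *: (U *m U^T)) G * 'X^2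
  = \det G *: ('X^n * char_poly (c *: S)).
Proof.
have -> : pencil_poly (c *: (U *m U^T)) G
        = \det G *: char_poly (invmx G *m (c *: U) *m U^T).
  rewrite /pencil_poly -mul_polyC -det_map_mx -det_mulmx; congr (\det _).
  rewrite /char_poly_mx mulmxBr mul_mx_scalar -map_mxM -!mulmxA.
  by rewrite mulKVmx ?posdef_unitmx // scalemxAl.
rewrite -scalerAl char_poly_mulmxC mulrC; congr (_ *: (_ * char_poly _)).
by rewrite -!scalemxAr.
Qed.


(* By Cauchy-Schwarz for G, x^T G x >= w^T S^-1 w with w = U^T x. *)
Lemma rank2_perturbation_posdef l1 l2 :
    l1 + l2 = c * \tr S -> l1 * l2 = c ^+ 2 * \det S ->
    -1 < l1 -> -1 < l2 ->
  posdef_on predT (G + c *: (U *m U^T)).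
Proof.
move=> sum_l prod_l l1_gt l2_gt x _ x0.
pose w := U^T *m x.
have -> : dot x ((G + c *: (U *m U^T)) *m x) = dot x (G *m x) + c * dot w w.
  by rewrite mulmxDl dotDr -scalemxAl dotZr -mulmxA (dot_trmx U).
have [w0|w_neq0] := eqVneq w 0.
  by rewrite w0 dot0r mulr0 addr0; apply: G_gt0.
pose z := invmx S *m w.
have S_unit : S \in unitmx.
  by rewrite unitmxE unitfE posdef_ker //; exact: gram_posdef.
have Sz : S *m z = w by rewrite mulKVmx.
(* Among the vectors with U^T y = w, this is the one of least G-energy, and its energy is w^T S^-1
   w. *)
pose y := invmx G *m (U *m z).
have Gy : G *m y = U *m z by rewrite mulKVmx // posdef_unitmx.
have UU : U^T *m y = w by rewrite -Sz -!mulmxA.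
have : 0 <= dot (x - y) (G *m (x - y)).
  have [->|xy] := eqVneq (x - y) 0; first by rewrite mulmx0 dot0r.
  by rewrite ltW // G_gt0.
have -> : dot (x - y) (G *m (x - y)) = dot x (G *m x) - dot w z.
  have xGy : dot x (G *m y) = dot w z by rewrite Gy dot_trmx.
  have yGx : dot y (G *m x) = dot w z by rewrite dot_trmx G_sym dotC.
  have yGy : dot y (G *m y) = dot w z by rewrite Gy dot_trmx UU.
  rewrite mulmxBr !(dotDr, dotDl) -!scaleN1r !(dotZl, dotZr) xGy yGx yGy.
  by ring.
rewrite subr_ge0; suff : 0 < dot w z + c * dot w w by lra.
pose a : R := S 0 0; pose b : R := S 0 1; pose d : R := S 1 1.
have S10 : S 1 0 = b by rewrite -[in LHS]gram_sym mxE.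
have det_S : \det S = a * d - b ^+ 2 by rewrite det_mx2 S10 expr2.
have tr_S : \tr S = a + d by rewrite /mxtrace sum_ord2.
have det_gt0 : 0 < a * d - b ^+ 2.
  by rewrite -det_S det_posdef //; exact: gram_posdef.
have a_gt0 : 0 < a.
  have : 0 < dot (delta_mx 0 0 : 'cV_2) (S *m delta_mx 0 0).
    apply: gram_posdef => //; apply/eqP => /matrixP/(_ 0 0)/eqP.
    by rewrite !mxE oner_eq0.
  by rewrite dot_delta.
have wE i : w i 0 = S i 0 * z 0 0 + S i 1 * z 1 0.
  by rewrite -Sz mxE sum_ord2.
(* It remains to see that S^-1 + c I is positive. Multiplied by e = det S it becomes adj S + c e I,
   an explicit binary form in w. *)
rewrite -(pmulr_rgt0 _ det_gt0).
pose e : R := a * d - b ^+ 2.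
have -> : (a * d - b ^+ 2) * (dot w z + c * dot w w)
        = (d + c * e) * w 0 0 ^+ 2 - 2 * b * w 0 0 * w 1 0
          + (a + c * e) * w 1 0 ^+ 2.
  by rewrite !dot2E !wE S10 -/a -/b -/d /e; ring.
rewrite det_S -/e in prod_l det_gt0; rewrite tr_S in sum_l.
have d_gt0 : 0 < d by rewrite /e in det_gt0; nra.
apply: binary_form_gt0.
(* The trace. It is clearly positive for c > 0; for c < 0 both roots lie in (-1, 0), and c times the
   trace is l1 (1 + l2) + l2 (1 + l1) < 0. *)
- have ce_gt0 : 0 < c ^+ 2 * e by rewrite mulr_gt0 // exprn_even_gt0.
  have := c_neq0; rewrite neq_lt => /orP[c_lt0|c_gt0]; last by nra.
  have sum_lt0 : l1 + l2 < 0 by rewrite sum_l nmulr_rlt0 // addr_gt0.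
  have [l1_lt0 l2_lt0] : l1 < 0 /\ l2 < 0 by split; nra.
  rewrite -(nmulr_rlt0 _ c_lt0).
  have -> : c * (d + c * e + (a + c * e)) = l1 * (1 + l2) + l2 * (1 + l1).
    transitivity (c * (a + d) + 2 * (c ^+ 2 * e)); first by ring.
    by rewrite -sum_l -prod_l; ring.
  by nra.
(* The determinant equals e (1 + l1) (1 + l2). *)
- rewrite -subr_gt0.
  have -> : (d + c * e) * (a + c * e) - b ^+ 2
          = e * (1 + (c * (a + d)) + c ^+ 2 * e) by rewrite /e; ring.
  rewrite -sum_l -prod_l mulr_gt0 //.
  have -> : 1 + (l1 + l2) + l1 * l2 = (1 + l1) * (1 + l2) by ring.
  by rewrite mulr_gt0 // addrC -ltrBlDr sub0r.
- apply: contraR w_neq0; rewrite negb_or !negbK => /andP[/eqP w0 /eqP w1].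
  by rewrite -dot_eq0 dot2E w0 w1 !mulr0 addr0.
Qed.

Lemma pencil_rank2 : exists l1 l2,
  [/\ l1 != 0, l2 != 0,
      pencil_poly (c *: (U *m U^T)) G * 'X^2
      = \det G *: ('X^n * (('X - l1%:P) * ('X - l2%:P)))
    & -1 < l1 -> -1 < l2 -> posdef_on predT (G + c *: (U *m U^T))].
Proof.
have [s1 [s2 [sum_s prod_s]]] := @sym2_eigenvalues _ S gram_sym.
have S_neq0 : \det S != 0 by apply: posdef_ker; exact: gram_posdef.
move: S_neq0; rewrite -prod_s mulf_eq0 negb_or => /andP[s1_neq0 s2_neq0].
(* The roots are c times the eigenvalues of S, which are nonzero because S is invertible. *)
exists (c * s1), (c * s2); split; rewrite ?mulf_neq0 //.
  rewrite pencil_poly_rank2 char_poly2 mxtraceZ detZ -sum_s -prod_s.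
  congr (_ *: (_ * _)); rewrite -mul_polyC expr2 !polyCM polyCD; ring.
by apply: rank2_perturbation_posdef; rewrite -?sum_s -?prod_s; ring.
Qed.
End RankTwoPencil.

(** * Stacked plane vectors and block Laplacians *)

Lemma sum_ord3 (V : nmodType) (F : 'I_3 -> V) : \sum_i F i = F 0 + F 1 + F 2.
Proof.
rewrite !big_ord_recl big_ord0 addr0 addrA.
by congr (_ + F _ + F _); apply: val_inj.
Qed.

Lemma sum_neq_lift0 (V : nmodType) n (F : 'I_n.+1 -> V) (a : 'I_n) :
  \sum_(k | k != lift ord0 a) F k
  = F ord0 + \sum_(b | b != a) F (lift ord0 b).
Proof.
by rewrite big_mkcond big_ord_recl /= -big_mkcond.
Qed.

Definition blk (R : realType) (x : 'cV[R]_(3 * 2)) (a : 'I_3) : 'cV[R]_2 :=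
  \col_s x (mxtens_index (a, s)) 0.

Lemma sum_mxtens (V : nmodType) m n (F : 'I_(m * n) -> V) :
  \sum_i F i = \sum_i \sum_j F (mxtens_index (i, j)).
Proof.
rewrite pair_big (reindex (@mxtens_index m n)) /=.
  by apply: eq_bigr => -[].
exists (@mxtens_unindex m n) => i _; first by rewrite mxtens_indexK.
by rewrite mxtens_unindexK.
Qed.

Lemma blkP (R : realType) (x y : 'cV[R]_(3 * 2)) :
  (forall a, blk x a = blk y a) -> x = y.
Proof.
move=> xy; apply/matrixP => i j; rewrite ord1.
case: (mxtens_indexP i) => a s.
by have /matrixP/(_ s 0) := xy a; rewrite !mxE.
Qed.

Lemma blkZ (R : realType) t (x : 'cV[R]_(3 * 2)) a :
  blk (t *: x) a = t *: blk x a.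
Proof. by apply/matrixP => i j; rewrite !mxE. Qed.

Lemma dot_blk (R : realType) (x y : 'cV[R]_(3 * 2)) :
  dot x y = \sum_a dot (blk x a) (blk y a).
Proof.
rewrite /dot sum_mxtens; apply: eq_bigr => a _.
by apply: eq_bigr => s _; rewrite !mxE.
Qed.

Lemma blk_block3 (R : realType) B (x : 'cV[R]_(3 * 2)) a :
  blk (block3 B *m x) a = \sum_b B a b *m blk x b.
Proof.
apply/matrixP => s j; rewrite !mxE sum_mxtens summxE.
apply: eq_bigr => b _; rewrite !mxE; apply: eq_bigr => t _.
by rewrite !mxE !mxtens_indexK.
Qed.

Lemma blk_tensmx (R : realType) (A : 'M[R]_3) (B : 'M[R]_2) x a :
  blk ((A *t B) *m x) a = \sum_b A a b *: (B *m blk x b).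
Proof.
apply/matrixP => s j; rewrite !mxE sum_mxtens summxE.
apply: eq_bigr => b _; rewrite !mxE mulr_sumr; apply: eq_bigr => t _.
by rewrite !mxE !mxtens_indexK mulrA.
Qed.

(** Taking D to be [Dmx m r] gives [gap_laplacian]; a general D lets the quadratic form be computed
    from the symmetry of D alone. *)
Definition laplacian (R : realType) (D : 'I_4 -> 'I_4 -> 'M[R]_2) :=
  block3 (fun a b =>
    if a == b then \sum_(k | k != lift ord0 a) D (lift ord0 a) k
    else - D (lift ord0 a) (lift ord0 b)).

Definition edge_energy (R : realType) (D : 'I_4 -> 'I_4 -> 'M[R]_2)
    (x y : 'cV[R]_(3 * 2)) (a b : 'I_3) :=
  dot (blk x a - blk x b)
      (D (lift ord0 a) (lift ord0 b) *m (blk y a - blk y b)).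

(* Body 1 is pinned at the origin. *)
Lemma dot_laplacian (R : realType) (D : 'I_4 -> 'I_4 -> 'M[R]_2) x y :
    (forall i j, D i j = D j i) ->
  dot x (laplacian D *m y)
  = \sum_a dot (blk x a) (D (lift ord0 a) ord0 *m blk y a)
    + (edge_energy D x y 0 1 + edge_energy D x y 0 2 + edge_energy D x y 1 2).
Proof.
move=> D_sym; rewrite dot_blk /edge_energy !sum_ord3 !blk_block3 !sum_ord3 /=.
rewrite !sum_neq_lift0.
have offdiag (F : 'I_3 -> 'M[R]_2) a :
    \sum_(b | b != a) F b = \sum_b (if b != a then F b else 0).
  by rewrite big_mkcond.
rewrite !offdiag !sum_ord3 /=.
rewrite !addr0 !add0r !(D_sym (lift ord0 1) (lift ord0 0)).
rewrite !(D_sym (lift ord0 2) (lift ord0 0)).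
rewrite !(D_sym (lift ord0 2) (lift ord0 1)).
rewrite !mulmxDl !mulmxBr !mulNmx !(dotDr, dotBl, dotBr).
rewrite -!scaleN1r !dotZr.
ring.
Qed.

Lemma trmx_dot (R : realType) n (A : 'M[R]_n) :
  (forall x y, dot x (A *m y) = dot y (A *m x)) -> A^T = A.
Proof.
by move=> A_sym; apply/matrixP => i j; rewrite mxE -!dot_delta A_sym.
Qed.

(** * Cross product and quarter turn in the plane *)

Definition cross (R : realType) (u v : 'cV[R]_2) : R :=
  u 0 0 * v 1 0 - u 1 0 * v 0 0.

Lemma cV2P (R : realType) (u v : 'cV[R]_2) :
  u 0 0 = v 0 0 -> u 1 0 = v 1 0 -> u = v.
Proof.
move=> uv0 uv1; apply/matrixP => i j; rewrite ord1.
case: (unliftP ord0 i) => [k|] ->; last exact: uv0.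
by rewrite ord1; have -> : lift ord0 0 = 1 :> 'I_2 by apply: val_inj.
Qed.

Lemma JmxE (R : realType) (u : 'cV[R]_2) :
  ((Jmx R *m u) 0 0 = - u 1 0) * ((Jmx R *m u) 1 0 = u 0 0).
Proof.
rewrite !mxE !sum_ord2 !mxE /= !subrr sub0r subr0.
by rewrite !mul0r mulN1r mul1r add0r addr0.
Qed.

Lemma dot_Jmx (R : realType) (u v : 'cV[R]_2) : dot u (Jmx R *m v) = cross v u.
Proof. by rewrite dot2E !JmxE /cross; ring. Qed.

(** In the orthogonal basis u, J u one has |u|^2 v = (u . v) u + (u x v) J u, and here the second
    term vanishes. *)
Lemma cross_eq0 (R : realType) (u v : 'cV[R]_2) :
  u != 0 -> cross u v = 0 -> v = (dot u v / dot u u) *: u.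
Proof.
move=> u0; rewrite /cross => uv0.
have uu0 : dot u u != 0 by rewrite dot_eq0.
have [h0 h1] : dot u u * v 0 0 = dot u v * u 0 0
            /\ dot u u * v 1 0 = dot u v * u 1 0.
  rewrite !dot2E; split.
    by rewrite -[LHS]addr0 -(mulr0 (u 1 0)) -uv0; ring.
  by rewrite -[LHS]subr0 -(mulr0 (u 0 0)) -uv0; ring.
by apply: cV2P; rewrite mxE mulrAC -?h0 -?h1 mulrC mulKf.
Qed.

(** The same decomposition, now with vanishing component along u. *)
Lemma dot_eq0_Jmx (R : realType) (u v : 'cV[R]_2) :
  u != 0 -> dot u v = 0 -> exists t, v = t *: (Jmx R *m u).
Proof.
move=> u0; rewrite dot2E => uv0; exists (cross u v / dot u u).
have uu0 : dot u u != 0 by rewrite dot_eq0.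
apply: cV2P; rewrite mxE JmxE mulrAC; apply: (canRL (mulfK uu0)).
  by rewrite dot2E /cross -[LHS]subr0 -(mulr0 (u 0 0)) -uv0; ring.
by rewrite dot2E /cross -[LHS]subr0 -(mulr0 (u 1 0)) -uv0; ring.
Qed.

(** * The gap Laplacian as the stiffness matrix of the complete graph *)

Section FourBodies.
Variables (R : realType) (m : 'I_4 -> R) (r : 'I_4 -> 'cV[R]_2).
Hypotheses (m_gt0 : forall i, 0 < m i) (r_inj : injective r).

Local Notation P a := (qvec r ord0 (lift ord0 a)).
Local Notation L := (gap_laplacian m r).
Local Notation v := (rot_mode r).

Lemma qvec_eq0 i j : (qvec r i j == 0) = (i == j).
Proof. by rewrite subr_eq0 (inj_eq r_inj). Qed.

Lemma qvecN i j : qvec r i j = - qvec r j i.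
Proof. by rewrite opprB. Qed.

Lemma qvec_lift a b : qvec r (lift ord0 a) (lift ord0 b) = P b - P a.
Proof. by rewrite /qvec opprB [RHS]addrC addrA subrK. Qed.

Lemma qdistC i j : qdist r i j = qdist r j i.
Proof.
by rewrite /qdist /enorm qvecN -scaleN1r dotZr dotZl mulN1r mulN1r opprK.
Qed.

Lemma qdist_gt0 i j : i != j -> 0 < qdist r i j.
Proof. by move=> ij; rewrite sqrtr_gt0 dot_gt0 qvec_eq0. Qed.

Lemma total_mass_gt0 : 0 < total_mass m.
Proof.
rewrite /total_mass (bigD1 ord0) //= ltr_wpDr ?m_gt0 //.
by apply: sumr_ge0 => i _; rewrite ltW.
Qed.

Lemma Dmx_sym i j : Dmx m r i j = Dmx m r j i.
Proof.
rewrite /Dmx /delta /mu /qhat qdistC (qvecN i j) (mulrC (m i)).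
by rewrite scalerN linearN /= mulmxN mulNmx opprK.
Qed.

(** [Dmx] has rank one along the edge, so only stretching counts. Pulling the normalization of
    [qhat] into the coefficient leaves factors bilinear in the positions and the displacements. *)
Lemma dot_Dmx i j x y :
  dot x (Dmx m r i j *m y)
  = delta m r i j / qdist r i j ^+ 2
    * (dot (qvec r i j) x * dot (qvec r i j) y).
Proof.
rewrite /Dmx /qhat -scalemxAl dotZr dot_outer !dotZl -exprVn expr2.
by ring.
Qed.

Lemma stiffness_gt0 i j : i != j -> 0 < delta m r i j / qdist r i j ^+ 2.
Proof.
move=> /qdist_gt0 q_gt0; rewrite /delta /mu.
by rewrite !(mulr_gt0, invr_gt0, exprn_gt0) // ?ltr0n // total_mass_gt0.
Qed.

Lemma blk_qcol a : blk (qcol r) a = P a.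
Proof. by apply/matrixP => s j; rewrite !mxE mxtens_indexK ord1. Qed.

Lemma blk_rot_mode a : blk v a = Jmx R *m P a.
Proof.
rewrite blk_tensmx (bigD1 a) //= big1 => [|b ba]; last first.
  by rewrite mxE eq_sym (negPf ba) scale0r.
by rewrite mxE eqxx scale1r addr0 blk_qcol.
Qed.

(** J preserves the norm, and q_12 is nonzero since the positions are distinct. *)
Lemma rot_mode_neq0 : v != 0.
Proof.
apply/eqP => v0.
have : dot (P 0) (P 0) = dot (Jmx R *m P 0) (Jmx R *m P 0).
  by rewrite !dot2E !JmxE; ring.
have -> : Jmx R *m P 0 = 0.
  by rewrite -blk_rot_mode v0; apply/matrixP => s j; rewrite !mxE.
by rewrite dot0r => /eqP; rewrite dot_eq0 qvec_eq0.
Qed.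

(** Up to sign, the first-order change of half the squared edge length under the displacement x. *)
Let edge x a b := dot (qvec r (lift ord0 a) (lift ord0 b)) (blk x a - blk x b).

(** Six edge terms with positive coefficients: three edges at body 1, then the three among bodies 2,
    3, 4. Symmetry, nonnegativity and the kernel are all read off from this form. *)
Lemma dot_gap x y :
  dot x (L *m y)
  = \sum_a delta m r (lift ord0 a) ord0 / qdist r (lift ord0 a) ord0 ^+ 2
           * (dot (P a) (blk x a) * dot (P a) (blk y a))
    + \sum_(ab <- [:: (0, 1); (0, 2); (1, 2)])
        delta m r (lift ord0 ab.1) (lift ord0 ab.2)
        / qdist r (lift ord0 ab.1) (lift ord0 ab.2) ^+ 2
        * (edge x ab.1 ab.2 * edge y ab.1 ab.2).
Proof.
rewrite (dot_laplacian _ _ Dmx_sym) /edge_energy !dot_Dmx.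
rewrite !big_cons big_nil addr0 !addrA; congr (_ + _ + _ + _).
apply: eq_bigr => a _; rewrite dot_Dmx qvecN; congr (_ * _).
by rewrite -scaleN1r !dotZl mulN1r mulN1r mulrNN.
Qed.

Lemma gap_sym : L^T = L.
Proof.
apply: trmx_dot => x y; rewrite !dot_gap.
by congr (_ + _); apply: eq_bigr => i _; rewrite [X in _ * X]mulrC.
Qed.

(** A rotation preserves every length to first order: J u is orthogonal to u, so each edge factor
    vanishes. *)
Lemma gap_rot_mode : L *m v = 0.
Proof.
apply: ker_dot => x; rewrite dot_gap.
rewrite !big1 ?addr0 // => [[a b]|a] _ /=.
  rewrite /edge !blk_rot_mode -mulmxBr dot_Jmx qvec_lift /cross !mxE.
  by ring.
by rewrite blk_rot_mode dot_Jmx /cross; ring.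
Qed.

Lemma ord3P (a : 'I_3) : [\/ a = 0, a = 1 | a = 2].
Proof.
by case: a => -[|[|[|//]]] i; [constructor 1|constructor 2|constructor 3];
  apply: val_inj.
Qed.

Lemma gap_ge0 x : 0 <= dot x (L *m x).
Proof.
rewrite dot_gap !big_cons big_nil addr0.
rewrite !addr_ge0 ?sumr_ge0 // => [a _|||];
  by rewrite mulr_ge0 -?expr2 ?sqr_ge0 // ltW // stiffness_gt0.
Qed.

(* The edges at body 1 make each block a multiple t_a of the rotated edge; the
   edges {2, 3} and {2, 4} then force t_2 = t_3 = t_4, by non-degeneracy of the
   triangles {1, 2, 3} and {1, 2, 4}. *)
Lemma gap_ker x :
    cross (P 0) (P 1) != 0 -> cross (P 0) (P 2) != 0 ->
  dot x (L *m x) = 0 -> exists t, x = t *: v.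
Proof.
move=> tri1 tri2; rewrite dot_gap !big_cons big_nil addr0 sum_ord3.
have term_ge0 i j u : i != j ->
    0 <= delta m r i j / qdist r i j ^+ 2 * (u * u).
  by move=> ij; rewrite mulr_ge0 -?expr2 ?sqr_ge0 // ltW // stiffness_gt0.
have term_eq0 i j u : i != j ->
    delta m r i j / qdist r i j ^+ 2 * (u * u) = 0 -> u = 0.
  move=> /stiffness_gt0/gt_eqF ij /eqP.
  by rewrite mulf_eq0 ij mulf_eq0 orbb => /eqP.
move/eqP; rewrite !paddr_eq0 ?addr_ge0 ?term_ge0 //.
case/andP=> /andP[/andP[/eqP/term_eq0 h0 /eqP/term_eq0 h1] /eqP/term_eq0 h2].
case/and3P=> /eqP/term_eq0 h01 /eqP/term_eq0 h02 _.
have P_neq0 a : P a != 0 by rewrite qvec_eq0.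
have [t0 x0] := dot_eq0_Jmx (P_neq0 0) (h0 isT).
have [t1 x1] := dot_eq0_Jmx (P_neq0 1) (h1 isT).
have [t2 x2] := dot_eq0_Jmx (P_neq0 2) (h2 isT).
move: (h01 isT) (h02 isT); rewrite /edge /= !qvec_lift x0 x1 x2.
have E (a b : 'cV[R]_2) s t :
    dot (b - a) (s *: (Jmx R *m a) - t *: (Jmx R *m b)) = (s - t) * cross a b.
  by rewrite dotBr !dotZr !dot_Jmx /cross !mxE; ring.
rewrite !E => /eqP; rewrite mulf_eq0 (negPf tri1) orbF subr_eq0 => /eqP t01.
move/eqP; rewrite mulf_eq0 (negPf tri2) orbF subr_eq0 => /eqP t02.
exists t0; apply: blkP => a.
rewrite blkZ blk_rot_mode.
by case: (ord3P a) => ->; rewrite ?x0 ?x1 ?x2 -?t01 -?t02.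
Qed.

(** * The matrix [ell] of a central configuration *)

Lemma sym_offdiag_neq0 (V : nmodType) (f : 'I_3 -> 'I_3 -> V) :
    (forall a b, f a b = f b a) ->
    f 0 1 != 0 -> f 0 2 != 0 -> f 1 2 != 0 ->
  forall a b, a != b -> f a b != 0.
Proof.
move=> fC f01 f02 f12 a b.
by case: (ord3P a) => ->; case: (ord3P b) => -> //; rewrite fC.
Qed.

(** The cross product in three dimensions of the two coordinate vectors of (q_12, q_13, q_14). Its
    entries are twice the signed areas of the triangles 134, 142 and 123. *)
Definition area : 'cV[R]_3 :=
  \col_a nth 0 [:: cross (P 1) (P 2); cross (P 2) (P 0); cross (P 0) (P 1)] a.

Lemma areaE :
  (area 0 0 = cross (P 1) (P 2)) * (area 1 0 = cross (P 2) (P 0))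
  * (area 2 0 = cross (P 0) (P 1)).
Proof. by rewrite !mxE. Qed.

Variable w2 : R.
Hypothesis (center0 : \sum_i m i *: r i = 0) (central : central_with m r w2).
(** With the center of mass at 0, sum_j m_j q_ij = M r_i. Scaling this by w2 m_i / M and subtracting
    the central equation produces the coefficients alpha_ij. *)
Lemma central_balance i :
  \sum_(j | j != i) alpha_perp m r w2 i j *: qvec r i j = 0.
Proof.
have [_ /(_ i) w2ri] := central.
have Mri : \sum_(j | j != i) m j *: qvec r i j = total_mass m *: r i.
  transitivity (\sum_j m j *: qvec r i j).
    by rewrite [RHS](bigD1 i) //= /qvec subrr scaler0 add0r.
  under eq_bigr do rewrite scalerBr.
  by rewrite big_split /= sumrN center0 subr0 scaler_suml.
have M_neq0 := gt_eqF total_mass_gt0.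
transitivity ((w2 * m i / total_mass m) *: \sum_(j | j != i) m j *: qvec r i j
   - \sum_(j | j != i) (m i * m j / qdist r i j ^+ 3) *: qvec r i j).
  rewrite scaler_sumr -sumrB; apply: eq_bigr => j ji.
  rewrite scalerA -scalerBl; congr (_ *: _).
  have q_neq0 := gt_eqF (qdist_gt0 (contra_neq esym ji)).
  by rewrite /alpha_perp /mu; field; rewrite q_neq0 M_neq0.
by rewrite Mri -w2ri scalerA divfK ?M_neq0 // subrr.
Qed.

(** This is the balance at body [lift ord0 a], negated, after expanding each q_ab as P b - P a. *)
Lemma ell_qvec a : \sum_b ell m r w2 a b *: P b = 0.
Proof.
have := central_balance (lift ord0 a).
rewrite sum_neq_lift0 qvecN => /eqP; rewrite -oppr_eq0 => /eqP balance.
rewrite (bigD1 a) //= mxE eqxx sum_neq_lift0 -[RHS]balance opprD scalerN opprK.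
rewrite scalerDl -addrA; congr (_ + _); rewrite scaler_suml -sumrN -big_split.
apply: eq_bigr => b ba /=; rewrite mxE eq_sym (negPf ba) qvec_lift.
by rewrite scaleNr -scalerBr -scalerN (opprB (P b)).
Qed.

Lemma alpha_perpC i j : alpha_perp m r w2 i j = alpha_perp m r w2 j i.
Proof. by rewrite /alpha_perp /mu qdistC (mulrC (m i)). Qed.

Lemma ell_sym a b : ell m r w2 a b = ell m r w2 b a.
Proof.
by rewrite !mxE (eq_sym b); case: eqP => [->|_] //; rewrite alpha_perpC.
Qed.

(** A row of [ell] is orthogonal to both coordinate vectors, hence proportional to [area]. Crossing
    the row relation with P 0, P 1 and P 2 gives the proportionality without any division. *)
Lemma ell_area a b c : ell m r w2 a b * area c 0 = ell m r w2 a c * area b 0.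
Proof.
have := ell_qvec a; rewrite sum_ord3; set e := ell m r w2 a => e0.
have e_cross (u : 'cV_2) :
    e 0 * cross (P 0) u + e 1 * cross (P 1) u + e 2 * cross (P 2) u = 0.
  transitivity (cross (e 0 *: P 0 + e 1 *: P 1 + e 2 *: P 2) u).
    by rewrite /cross !mxE; ring.
  by rewrite e0 /cross !mxE; ring.
have crossN (u w : 'cV[R]_2) : cross w u = - cross u w by rewrite /cross; ring.
have cross0 (u : 'cV[R]_2) : cross u u = 0 by rewrite /cross; ring.
move: (e_cross (P 0)) (e_cross (P 1)) (e_cross (P 2)).
rewrite !cross0 (crossN (P 0) (P 1)) (crossN (P 1) (P 2)) (crossN (P 2) (P 0)).
by case: (ord3P b) => ->; case: (ord3P c) => ->; rewrite !areaE; lra.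
Qed.

(** If all three areas vanish, each P a is a multiple of P 0, and the bodies lie on the line through
    bodies 1 and 2. *)
Lemma area_neq0 : ~ collinear r -> area != 0.
Proof.
move=> noncol; apply/eqP => y0; apply: noncol.
have P0_neq0 : P 0 != 0 by rewrite qvec_eq0.
have P0P a : cross (P 0) (P a) = 0.
  case: (ord3P a) => ->; first by rewrite /cross; ring.
    by rewrite -areaE y0 mxE.
  have : area 1 0 = 0 by rewrite y0 mxE.
  by rewrite areaE /cross; lra.
exists (r ord0), (P 0); split=> // i.
have [a|] := unliftP ord0 i => ->; last by exists 0; rewrite scale0r addr0.
have /(cross_eq0 P0_neq0) Pa := P0P a.
exists (- (dot (P 0) (P a) / dot (P 0) (P 0))).
by rewrite scaleNr -Pa opprB addrC subrK.
Qed.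

Hypotheses (noncollinear : ~ collinear r).
Hypothesis offdiag_neq0 : forall a b, a != b -> ell m r w2 a b != 0.

(** If y_b = 0, proportionality of row a for some a other than b gives ell_ab y_c = 0 for every c,
    so the whole vector y vanishes. *)
Lemma area_entry_neq0 b : area b 0 != 0.
Proof.
apply/eqP => yb0; case/eqP: (area_neq0 noncollinear).
have [a ab] : exists a, a != b.
  by exists (if b == 0 then 1 else 0); case: (ord3P b) => ->.
apply/matrixP => c j; rewrite ord1 [RHS]mxE.
apply/eqP; have /eqP := ell_area a b c.
by rewrite yb0 mulr0 mulf_eq0 (negPf (offdiag_neq0 ab)).
Qed.

(** Rows are proportional to [area], and by symmetry so are columns; the scalar is read off at entry
    (0, 0). Were it zero, the off-diagonal entries would vanish. *)
Lemma ell_rank1 :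
  exists2 c, c != 0 & ell m r w2 = c *: (area *m area^T).
Proof.
have y0 := area_entry_neq0 0.
have row a b : ell m r w2 a b = ell m r w2 a 0 / area 0 0 * area b 0.
  by rewrite mulrAC -ell_area mulfK.
have ellE a b : ell m r w2 a b
    = ell m r w2 0 0 / area 0 0 ^+ 2 * (area a 0 * area b 0).
  by rewrite row (ell_sym a) row; field.
exists (ell m r w2 0 0 / area 0 0 ^+ 2); last first.
  by apply/matrixP => a b; rewrite ellE !mxE big_ord1 !mxE.
by apply/eqP => c0; have := @offdiag_neq0 0 1 isT; rewrite ellE c0 mul0r eqxx.
Qed.

(** * The regularized gap Laplacian and the factorization of [Ltilde] *)

Lemma gap_reg_sym : (gap_laplacian_reg m r)^T = gap_laplacian_reg m r.
Proof.
by rewrite linearD /= gap_sym linearZ /= trmx_mul trmxK.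
Qed.

Lemma dot_gap_reg x y :
  dot x (gap_laplacian_reg m r *m y)
  = dot x (L *m y) + (dot v v)^-1 * (dot v x * dot v y).
Proof. by rewrite mulmxDl dotDr -scalemxAl dotZr dot_outer enorm_sqr. Qed.

Lemma gap_reg_orth x : dot v x = 0 -> gap_laplacian_reg m r *m x = L *m x.
Proof.
move=> vx0; rewrite mulmxDl -scalemxAl -mulmxA.
suff -> : v^T *m x = 0 by rewrite mulmx0 scaler0 addr0.
by apply/matrixP => i j; rewrite !ord1 -dotE vx0 mxE.
Qed.

(** Off W the added rank-one term is positive. On W, zero energy forces x to be a multiple of v
    orthogonal to v, hence 0. *)
Lemma gap_reg_posdef : posdef_on predT (gap_laplacian_reg m r).
Proof.
move=> x _ x_neq0; rewrite dot_gap_reg.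
have vv_gt0 : 0 < dot v v by rewrite dot_gt0 rot_mode_neq0.
have [vx0|vx_neq0] := eqVneq (dot v x) 0; last first.
  rewrite ltr_wpDl ?gap_ge0 // mulr_gt0 ?invr_gt0 // -expr2.
  by rewrite exprn_even_gt0.
rewrite vx0 !mulr0 addr0 lt_def gap_ge0 andbT.
apply: contraNneq x_neq0 => /gap_ker[||t xE].
- by rewrite -areaE area_entry_neq0.
- have := area_entry_neq0 1; rewrite areaE; apply: contra_neq.
  by rewrite /cross; lra.
- move/eqP: vx0; rewrite xE dotZr mulf_eq0 (gt_eqF vv_gt0) orbF => /eqP->.
  by rewrite scale0r.
Qed.

(** Each block is J applied to a row relation of [ell_qvec]. *)
Lemma Ltilde_rot_mode : Ltilde m r w2 *m v = 0.
Proof.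
apply: blkP => a; rewrite blk_tensmx.
transitivity (Jmx R *m (\sum_b ell m r w2 a b *: P b)); last first.
  by rewrite ell_qvec mulmx0; apply/matrixP => s j; rewrite !mxE.
rewrite mulmx_sumr; apply: eq_bigr => b _.
by rewrite mul1mx blk_rot_mode scalemxAr.
Qed.

Lemma Ltilde_rank2 : exists c (U : 'M[R]_(3 * 2, 2)),
  [/\ c != 0, Ltilde m r w2 = c *: (U *m U^T)
    & forall z : 'cV_2, U *m z = 0 -> z = 0].
Proof.
have [c c_neq0 ellE] := ell_rank1.
(* U is [area] tensored with I_2, written entrywise to have 2 columns. Block 0 of U z is y_0 z,
   which gives injectivity. *)
pose U : 'M[R]_(3 * 2, 2) :=
  \matrix_(i, s) (area (mxtens_unindex i).1 0 * (s == (mxtens_unindex i).2)%:R).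
exists c, U; split=> // [|z Uz].
  apply/matrixP => i j; rewrite /Ltilde ellE.
  case: (mxtens_indexP i) => a s; case: (mxtens_indexP j) => b t.
  rewrite tensmxE !mxE big_ord1 (bigD1 s) //= big1 => [|k ks]; last first.
    by rewrite !mxE !mxtens_indexK (negPf ks) mulr0 mul0r.
  by rewrite !mxE !mxtens_indexK eqxx /=; ring.
apply/matrixP => s j; rewrite ord1 mxE.
have /matrixP/(_ (mxtens_index (0, s)) 0) := Uz.
rewrite !mxE (bigD1 s) //= big1 => [|t ts].
  rewrite [U _ _]mxE mxtens_indexK eqxx mulr1 addr0 => /eqP.
  by rewrite mulf_eq0 (negPf (area_entry_neq0 0)) => /eqP.
by rewrite !mxE mxtens_indexK (negPf ts) mulr0 mul0r.
Qed.
End FourBodies.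

(** * The pencil of the configuration and definiteness on W *)

Theorem proposition5p12 (R : realType) (m : 'I_4 -> R) (r : 'I_4 -> 'cV[R]_2)
    (w2 : R)
    (m_gt0 : forall i, 0 < m i)
    (r_inj : injective r)
    (center0 : \sum_i m i *: r i = 0)
    (central : central_with m r w2)
    (noncollinear : ~ collinear r)
    (alpha23 : alpha_perp m r w2 body2 body3 != 0)
    (alpha24 : alpha_perp m r w2 body2 body4 != 0)
    (alpha34 : alpha_perp m r w2 body3 body4 != 0) :
  let P := pencil_poly (Ltilde m r w2) (gap_laplacian_reg m r) in
  let W := orth_compl (rot_mode r) in
  let c6 := \det (gap_laplacian_reg m r) in
  0 < c6 /\
  exists c4 c5 : R,
    let Q := c6 *: 'X^2 + c5 *: 'X + c4%:P in
    P = 'X^4 * Q /\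
    exists l1 l2 : R,
      [/\ Q = c6 *: (('X - l1%:P) * ('X - l2%:P)),
          forall lam : R,
            (lam != 0 /\
             gen_eigenvalue_on W (Ltilde m r w2) (gap_laplacian m r) lam)
            <-> (lam = l1 \/ lam = l2)
        & posdef_on W (restricted_hessian m r w2) <-> (-1 < l1 /\ -1 < l2)].
Proof.
move=> P W c6.
have offdiag_neq0 a b : a != b -> ell m r w2 a b != 0.
  have body (a' : 'I_3) (i : 'I_4) :
    lift ord0 a' = i :> nat -> lift ord0 a' = i by exact: val_inj.
  have ell_alpha a' b' : a' != b' ->
      (ell m r w2 a' b' != 0)
      = (alpha_perp m r w2 (lift ord0 a') (lift ord0 b') != 0).
    by move=> ab; rewrite mxE (negPf ab) oppr_eq0.
  apply: sym_offdiag_neq0; first exact: ell_sym.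
  - by rewrite ell_alpha // (body 0 body2) // (body 1 body3).
  - by rewrite ell_alpha // (body 0 body2) // (body 2 body4).
  - by rewrite ell_alpha // (body 1 body3) // (body 2 body4).
set G := gap_laplacian_reg m r in P c6 *; set Lt := Ltilde m r w2 in P *.
set L := gap_laplacian m r; set v := rot_mode r in W *.
have G_gt0 : posdef_on predT G.
  exact: (gap_reg_posdef m_gt0 r_inj center0 central).
have G_sym : G^T = G by exact: gap_reg_sym.
have vv_gt0 : 0 < dot v v by rewrite dot_gt0 rot_mode_neq0.
have Lv0 : L *m v = 0 by exact: gap_rot_mode.
have Ltv0 : Lt *m v = 0 by exact: (Ltilde_rot_mode m_gt0 r_inj center0 central).
have [c [U [c_neq0 LtE U_inj]]] : exists c (U : 'M[R]_(3 * 2, 2)),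
    [/\ c != 0, Lt = c *: (U *m U^T) & forall z : 'cV_2, U *m z = 0 -> z = 0].
  exact: (Ltilde_rank2 m_gt0 r_inj center0 central noncollinear offdiag_neq0).
have Lt_sym : Lt^T = Lt by rewrite LtE linearZ /= trmx_mul trmxK.
have GW x : x \in W -> G *m x = L *m x by move=> /eqP; apply: gap_reg_orth.
have c6_gt0 : 0 < c6 := det_posdef G_gt0.
split=> //.
have [l1 [l2 [l1_neq0 l2_neq0 PE posdef_l]]] :=
  pencil_rank2 G_sym G_gt0 c_neq0 U_inj.
(* The coefficients come from expanding c6 (X - l1) (X - l2). *)
exists (c6 * (l1 * l2)), (- (c6 * (l1 + l2))) => Q.
have QE : Q = c6 *: (('X - l1%:P) * ('X - l2%:P)).
  by rewrite /Q -!mul_polyC polyCN !polyCM polyCD; ring.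
have PQ : P = 'X^4 * Q.
  (* The pencil identity carries X^2 on the left and X^6 on the right, as n = 3 * 2; cancelling X^2
     leaves X^4. *)
  have X2_neq0 : 'X^2 != 0 :> {poly R} by rewrite expf_neq0 ?polyX_eq0.
  apply: (mulIf X2_neq0); rewrite /P LtE PE QE -/c6 (exprD 'X 4 2).
  by rewrite -!mul_polyC; ring.
split=> //; exists l1, l2.
have P_horner lam : P.[lam] = \det (lam *: G - Lt).
  rewrite -horner_evalE -det_map_mx; congr (\det _); apply/matrixP => i j.
  by rewrite !mxE /= horner_evalE !hornerE.
have Plam lam : lam != 0 -> P.[lam] = 0 <-> (lam = l1 \/ lam = l2).
  move=> lam_neq0; rewrite PQ QE !hornerE /=.
  split=> [/eqP|[->|->]]; [|by rewrite subrr; ring|by rewrite subrr; ring].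
  rewrite 3!mulf_eq0 expf_eq0 (negPf lam_neq0) (gt_eqF c6_gt0) /= !subr_eq0.
  by case/orP=> /eqP; [left | right].
have eigP lam :
    (lam != 0 /\ gen_eigenvalue_on W Lt L lam) <-> (lam = l1 \/ lam = l2).
  split=> [[lam_neq0 [x [xW x_neq0 Ltx]]]|lamE].
    apply/(Plam _ lam_neq0); rewrite P_horner; apply/det0_ker; exists x => //.
    by rewrite mulmxBl -scalemxAl GW // -Ltx subrr.
  have lam_neq0 : lam != 0 by case: lamE => ->.
  split=> //; move/(Plam _ lam_neq0): lamE; rewrite P_horner.
  case/det0_ker=> x x_neq0.
  rewrite mulmxBl -scalemxAl => /eqP; rewrite subr_eq0 => /eqP Ltx.
  (* Pair Lt x = lam G x with v: the left side vanishes since Lt is symmetric and kills v, while v .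
     G x = v . x because L v = 0. *)
  have xW : x \in W.
    have : dot v (lam *: (G *m x)) = 0.
      by rewrite Ltx dot_trmx Lt_sym Ltv0 dotC dot0r.
    have -> : dot v (lam *: (G *m x)) = lam * dot v x.
      rewrite dotZr dot_gap_reg dot_trmx gap_sym Lv0 (dotC 0) dot0r add0r.
      by rewrite mulKf ?gt_eqF.
    by move=> /eqP; rewrite mulf_eq0 (negPf lam_neq0).
  by exists x; split=> //; rewrite -GW.
split=> //; split=> [H_gt0|[l1_gt l2_gt] x xW x_neq0]; last first.
  (* G + Lt is positive on the whole space and agrees with the restricted Hessian on W. *)
  have := posdef_l l1_gt l2_gt x isT x_neq0.
  by rewrite -LtE mulmxDl GW // -mulmxDl.
suff l_gt l : l = l1 \/ l = l2 -> -1 < l by split; apply: l_gt; [left | right].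
move/eigP => [l_neq0 [x [xW x_neq0 Ltx]]].
(* Conversely, an eigenvector in W for the root l tests the Hessian: x^T H x = (1 + l) x^T G x. *)
have Hx : restricted_hessian m r w2 *m x = (1 + l) *: (G *m x).
  by rewrite mulmxDl Ltx -GW // scalerDl scale1r.
have := H_gt0 x xW x_neq0; rewrite Hx dotZr pmulr_lgt0 ?G_gt0 //.
by rewrite addrC -ltrBlDr sub0r.
Qed.
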